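(* (Exponential isomorphism.) Let $k$ be a field of characteristic $0$ and let $V$ be an associative commutative (nonunital) $k$-algebra. Let $\phi:T(V)\to T(V)$ be the linear map with $\phi(1)=1$ and, for $n\ge1$ and $x_1,\dots,x_n\in V$, $$\phi(x_1\cdots x_n)=\sum_{m=1}^n\ \sum_{\substack{i_1+\cdots+i_m=n\\ i_1,\dots,i_m\ge1}}\frac{1}{i_1!\cdots i_m!}\,(x_1\cdots x_{i_1})_V\otimes(x_{i_1+1}\cdots x_{i_1+i_2})_V\otimes\cdots\otimes(x_{i_1+\cdots+i_{m-1}+1}\cdots x_n)_V,$$ where $(y_1\cdots y_j)_V\in V$ denotes the product of $y_1,\dots,y_j$ in the algebra $V$. Then $\phi$ is a Hopf algebra isomorphism from $T(V)$ with the shuffle product and the deconcatenation coproduct $\Delta$ to $T(V)$ with the quasi-shuffle product and the deconcatenation coproduct $\Delta$.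
   Context: $T(V)=\bigoplus_{n\ge0}V^{\otimes n}$, elements $x_1\cdots x_n=x_1\otimes\cdots\otimes x_n$ are called words. The quasi-shuffle product $\star$ is defined inductively by $1\star v=v\star1=v$ and, for $a,b\in V$ and words $v,w$, $av\star bw=a(v\star bw)+b(av\star w)+(a\cdot b)(v\star w)$, where $a\cdot b$ is the product of $V$. The shuffle product is given by the same recursion without the last term. The coproduct is $\Delta(x_1\cdots x_n)=\sum_{i=0}^nx_1\cdots x_i\otimes x_{i+1}\cdots x_n$. *)

(* Defs.v *)
From HB Require Import structures.
From mathcomp Require Import all_boot all_algebra.
From mathcomp Require Import generic_quotient ring_quotient sesquilinear.
From mathcomp Require Import boolp.
From mathcomp Require Import freeg.

Set Implicit Arguments.
Unset Strict Implicit.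
Unset Printing Implicit Defensive.

Import GRing.Theory.
Local Open Scope ring_scope.
Local Open Scope quotient_scope.

Section FreeLift.
Variables (k : fieldType) (X : choiceType) (M : lmodType k).

HB.instance Definition _ (f : X -> M) := GRing.isZmodMorphism.Build
  {freeg X / k} M (fglift f) (lift_is_additive f).

Lemma fglift_scalable (f : X -> M) : scalable (fglift f).
Proof.
move=> c D; rewrite -[D in RHS]freeg_sumE [in RHS]raddf_sum scaler_sumr.
rewrite -[c *: D]/(fgscale c D) /fgscale raddf_sum; apply: eq_bigr => x _ /=.
by rewrite !liftU scalerA.
Qed.

Lemma fglift_linear (f : X -> M) : linear (fglift f).
Proof. by move=> c x y; rewrite raddfD /= fglift_scalable. Qed.

Lemma fglift_rel (f : X -> M) a x y z :
  f x = a *: f y + f z ->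
  fglift f (<< x >> - (a *: << y >> + << z >>)) = 0.
Proof.
move=> E; rewrite -scaleN1r addrC !fglift_linear !liftU !scale1r E.
by rewrite scaleN1r addNr.
Qed.

Lemma freeg_ext (f g : {freeg X / k} -> M) :
  linear f -> linear g -> (forall x, f << x >> = g << x >>) -> f =1 g.
Proof.
move=> fl gl fg.
have z (h : {freeg X / k} -> M) : linear h -> h 0 = 0.
  by move=> hl; have := hl (-1) 0 0; rewrite !scaleN1r oppr0 addr0 addNr.
have U c x : << c *g x >> = c *: << x >> :> {freeg X / k}.
  by apply/eqP/freeg_eqP=> t; rewrite coeffZ !coeffU mul1r.
elim/freeg_ind_dom0=> [|c x D _ _ IH]; first by rewrite !z.
by rewrite U fl gl fg IH.
Qed.

End FreeLift.

(** The module with generators X and relations rel: the quotient of the free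
    module on X by the submodule spanned by the elements satisfying rel. *)
Section Presented.
Variables (k : fieldType) (X : choiceType) (rel : {freeg X / k} -> Prop).

Inductive rel_span : {freeg X / k} -> Prop :=
| rel_span0 : rel_span 0
| rel_spanD a r x : rel r -> rel_span x -> rel_span (a *: r + x).

Definition in_rel_span : {freeg X / k} -> bool := fun x => `[< rel_span x >].

Lemma rel_span_lin a x y : rel_span x -> rel_span y -> rel_span (a *: x + y).
Proof.
move=> + hy; elim=> [|b r z rr _ IH]; first by rewrite scaler0 add0r.
by rewrite scalerDr scalerA -addrA; constructor.
Qed.

Lemma in_rel_span_closed : zmod_closed in_rel_span.
Proof.
split; first by apply/asboolP; constructor.
move=> x y /asboolP hx /asboolP hy; apply/asboolP.
by rewrite addrC -scaleN1r; apply: rel_span_lin.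
Qed.

HB.instance Definition _ :=
  GRing.isZmodClosed.Build {freeg X / k} in_rel_span in_rel_span_closed.

Let span_closed := GRing.ZmodClosed.clone {freeg X / k} in_rel_span _.

Definition presented : Type := Quotient.quot span_closed.

HB.instance Definition _ := Choice.on presented.
HB.instance Definition _ := EqQuotient.on presented.
HB.instance Definition _ := GRing.Zmodule.on presented.

Definition pscale (a : k) (q : presented) : presented :=
  \pi_presented (a *: repr q).

Lemma pi_presentedD x y :
  \pi_presented (x + y) = \pi_presented x + \pi_presented y.
Proof. exact: Quotient.pi_add. Qed.

Lemma pi_presentedP x y :
  rel_span (x - y) <-> \pi_presented x = \pi_presented y.
Proof.
have E := Quotient.idealrBE span_closed x y.
split=> [h|h]; first by apply/eqP; rewrite -E; apply/asboolP.
by apply/asboolP; apply: (etrans E); apply/eqP.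
Qed.

Lemma pi_pscale a x : \pi_presented (a *: x) = pscale a (\pi_presented x).
Proof.
apply/pi_presentedP; rewrite -scalerBr -[_ *: _]addr0.
apply: rel_span_lin; last by constructor.
by apply/pi_presentedP; rewrite reprK.
Qed.

Lemma pscaleA a b v : pscale a (pscale b v) = pscale (a * b) v.
Proof.
rewrite -[v]reprK; move: (repr v) => x.
by rewrite -(pi_pscale b x) -(pi_pscale a) -(pi_pscale (a * b) x)
  scalerA.
Qed.

Lemma pscale1 : left_id 1 pscale.
Proof.
move=> v; rewrite -[v]reprK; move: (repr v) => x.
by rewrite -(pi_pscale 1 x) scale1r.
Qed.

Lemma pscaleDr : right_distributive pscale +%R.
Proof.
move=> a u v; rewrite -[u]reprK -[v]reprK; move: (repr u) (repr v) => x y.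
by rewrite -(pi_pscale a x) -(pi_pscale a y) -!pi_presentedD
  -(pi_pscale a (x + y)) scalerDr.
Qed.

Lemma pscaleDl v : {morph pscale^~ v : a b / a + b}.
Proof.
move=> a b; rewrite -[v]reprK; move: (repr v) => x.
by rewrite -(pi_pscale a x) -(pi_pscale b x) -!pi_presentedD
  -(pi_pscale (a + b) x) scalerDl.
Qed.

HB.instance Definition _ := GRing.Zmodule_isLmodule.Build k presented
  pscaleA pscale1 pscaleDr pscaleDl.

Lemma pi_presentedZ a x : \pi_presented (a *: x) = a *: \pi_presented x.
Proof. exact: pi_pscale. Qed.

Definition pgen (x : X) : presented := \pi_presented << x >>.

Lemma pgen_rel a x y z :
  rel (<< x >> - (a *: << y >> + << z >>)) -> pgen x = a *: pgen y + pgen z.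
Proof.
move=> r; rewrite /pgen -pi_presentedZ -pi_presentedD; apply/pi_presentedP.
by rewrite -[X in rel_span X]addr0 -[_ - _]scale1r; constructor; last constructor.
Qed.

Section Lift.
Variables (M : lmodType k) (f : X -> M).
Hypothesis fP : forall r, rel r -> fglift f r = 0.

Definition plift of (forall r, rel r -> fglift f r = 0) : presented -> M :=
  fun q => fglift f (repr q).

Lemma fglift_rel_span x : rel_span x -> fglift f x = 0.
Proof.
elim=> [|a r y rr _ IH]; first by rewrite raddf0.
by rewrite fglift_linear IH fP // scaler0 addr0.
Qed.

Lemma plift_pi x : plift fP (\pi_presented x) = fglift f x.
Proof.
apply/eqP; rewrite -subr_eq0 -raddfB; apply/eqP/fglift_rel_span.
by apply/pi_presentedP; rewrite reprK.
Qed.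

Lemma plift_linear : linear (plift fP).
Proof.
move=> a u v; rewrite -[u]reprK -[v]reprK; move: (repr u) (repr v) => x y.
by rewrite -pi_presentedZ -pi_presentedD !plift_pi fglift_linear.
Qed.

HB.instance Definition _ := GRing.isLinear.Build k presented M *:%R (plift fP)
  plift_linear.

Lemma plift_gen x : plift fP (pgen x) = f x.
Proof. by rewrite plift_pi liftU scale1r. Qed.

End Lift.

Lemma presented_ext (M : lmodType k) (f g : {linear presented -> M}) :
  (forall x, f (pgen x) = g (pgen x)) -> f =1 g.
Proof.
move=> fg q; rewrite -[q]reprK; set D := repr q.
have l (h : {linear presented -> M}) : linear (fun x => h (\pi_presented x)).
  by move=> a x y; rewrite pi_presentedD pi_presentedZ linearP.
exact: (freeg_ext (l f) (l g)).
Qed.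

End Presented.

Section Tensor.
Variables (k : fieldType).

Section Def.
Variables (U W : lmodType k).
Local Notation F := {freeg (U * W)%type / k}.

Inductive tensor_rel : F -> Prop :=
| TensorRelL a u u' w :
    tensor_rel (<< (a *: u + u', w) >> - (a *: << (u, w) >> + << (u', w) >>))
| TensorRelR a u w w' :
    tensor_rel (<< (u, a *: w + w') >> - (a *: << (u, w) >> + << (u, w') >>)).

Definition tensor : Type := presented tensor_rel.

HB.instance Definition _ := GRing.Lmodule.on tensor.

Definition tens (u : U) (w : W) : tensor := pgen tensor_rel (u, w).

Lemma tens_bilinear : bilinear_for *:%R *:%R tens.
Proof.
by split=> [w|u] a x y; apply: pgen_rel; constructor.
Qed.

HB.instance Definition _ :=
  bilinear_isBilinear.Build k U W tensor *:%R *:%R tens tens_bilinear.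

Variable M : lmodType k.

Lemma tlift_subproof (f : {bilinear U -> W -> M}) r :
  tensor_rel r -> fglift (fun p : U * W => f p.1 p.2) r = 0.
Proof.
case=> [a u u' w|a u w w']; apply: fglift_rel => /=; first exact: linearPl.
exact: linearPr.
Qed.

Definition tlift (f : {bilinear U -> W -> M}) : tensor -> M :=
  plift (tlift_subproof f).

HB.instance Definition _ (f : {bilinear U -> W -> M}) :=
  GRing.Linear.copy (tlift f) (plift (tlift_subproof f)).

Lemma tlift_tens (f : {bilinear U -> W -> M}) u w : tlift f (tens u w) = f u w.
Proof. by rewrite /tlift plift_gen. Qed.

Lemma tensor_ext (f g : {linear tensor -> M}) :
  (forall u w, f (tens u w) = g (tens u w)) -> f =1 g.
Proof. by move=> fg; apply: presented_ext => -[u w]; apply: fg. Qed.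

Lemma tlift_lin a (f g h : {bilinear U -> W -> M}) z :
  (forall u w, f u w = a *: g u w + h u w) ->
  tlift f z = a *: tlift g z + tlift h z.
Proof.
move=> E; apply: (@tensor_ext (tlift f) (a \*: tlift g \+ tlift h)) => u w /=.
by rewrite !tlift_tens.
Qed.

End Def.

Section Map.
Variables (U U' W W' : lmodType k).

Definition tmap_fun (f : {linear U -> U'}) (g : {linear W -> W'}) u w :=
  tens (f u) (g w).

Lemma tmap_bilinear f g : bilinear_for *:%R *:%R (tmap_fun f g).
Proof.
split=> [w|u] a x y; rewrite /tmap_fun linearP; first by rewrite linearPl.
by rewrite linearPr.
Qed.

HB.instance Definition _ f g := bilinear_isBilinear.Build k U W (tensor U' W')
  *:%R *:%R (tmap_fun f g) (tmap_bilinear f g).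

Definition tmap (f : {linear U -> U'}) (g : {linear W -> W'}) :
  tensor U W -> tensor U' W' := tlift (tmap_fun f g).

HB.instance Definition _ f g :=
  GRing.Linear.copy (tmap f g) (tlift (tmap_fun f g)).

Lemma tmap_tens f g u w : tmap f g (tens u w) = tens (f u) (g w).
Proof. exact: tlift_tens. Qed.

End Map.

Section Assoc.
Variables (U W X : lmodType k).

Definition tassoc_fun2 (x : X) (u : U) (w : W) := tens u (tens w x).

Lemma tassoc_fun2_bilinear x : bilinear_for *:%R *:%R (tassoc_fun2 x).
Proof.
split=> [w|u] a y z; rewrite /tassoc_fun2; first by rewrite linearPl.
by rewrite [tens (_ + _) _]linearPl linearPr.
Qed.

HB.instance Definition _ x := bilinear_isBilinear.Build k U W
  (tensor U (tensor W X)) *:%R *:%R (tassoc_fun2 x) (tassoc_fun2_bilinear x).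

Definition tassoc_fun z x := tlift (tassoc_fun2 x) z.

Lemma tassoc_bilinear : bilinear_for *:%R *:%R tassoc_fun.
Proof.
split=> [x|z] a y y'; rewrite /tassoc_fun; first by rewrite linearP.
by apply: tlift_lin => u w; rewrite /= /tassoc_fun2 !linearPr.
Qed.

HB.instance Definition _ := bilinear_isBilinear.Build k (tensor U W) X
  (tensor U (tensor W X)) *:%R *:%R tassoc_fun tassoc_bilinear.

Definition tassoc : tensor (tensor U W) X -> tensor U (tensor W X) :=
  tlift tassoc_fun.

Lemma tassoc_tens u w x : tassoc (tens (tens u w) x) = tens u (tens w x).
Proof. by rewrite /tassoc tlift_tens /= /tassoc_fun tlift_tens. Qed.

End Assoc.

End Tensor.

Section HopfAlgebra.
Variable k : fieldType.

Record hopf_ops (H : lmodType k) := HopfOps {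
  hone : H;
  hmul : {bilinear H -> H -> H};
  hcounit : {linear H -> k^o};
  hcomul : {linear H -> tensor H H} }.

Section Ops.
Variables (H : lmodType k) (A : hopf_ops H).

Definition tmul_fun (Y : tensor H H) (a b : H) : tensor H H :=
  tmap (hmul A a) (hmul A b) Y.

Lemma tmul_fun_bilinear Y : bilinear_for *:%R *:%R (tmul_fun Y).
Proof.
split=> b a x y; apply: tlift_lin => u w.
  apply: etrans (linearPl (@tens k H H) _ _ _ _).
  by rewrite -(linearPl (hmul A)).
apply: etrans (linearPr (@tens k H H) _ _ _ _).
by rewrite -(linearPl (hmul A)).
Qed.

HB.instance Definition _ Y := bilinear_isBilinear.Build k H H (tensor H H)
  *:%R *:%R (tmul_fun Y) (tmul_fun_bilinear Y).

Definition tmul (Z Y : tensor H H) : tensor H H := tlift (tmul_fun Y) Z.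

Lemma tmul_tens a b c d :
  tmul (tens a b) (tens c d) = tens (hmul A a c) (hmul A b d).
Proof. by rewrite /tmul tlift_tens /= /tmul_fun tmap_tens. Qed.

Definition conv_fun (f g : {linear H -> H}) (x y : H) : H := hmul A (f x) (g y).

Lemma conv_fun_bilinear f g : bilinear_for *:%R *:%R (conv_fun f g).
Proof.
by split=> [b|b] a x y; rewrite /conv_fun ?linearP ?linearPl ?linearPr.
Qed.

HB.instance Definition _ f g := bilinear_isBilinear.Build k H H H
  *:%R *:%R (conv_fun f g) (conv_fun_bilinear f g).

(** The convolution product of two endomorphisms. *)
Definition conv (f g : {linear H -> H}) (x : H) : H :=
  tlift (conv_fun f g) (hcomul A x).

Definition is_antipode (S : {linear H -> H}) : Prop :=
  forall x, conv S idfun x = hcounit A x *: hone A /\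
            conv idfun S x = hcounit A x *: hone A.

Definition lcounit_fun (x y : H) : H := (hcounit A x : k) *: y.
Definition rcounit_fun (x y : H) : H := (hcounit A y : k) *: x.

Lemma lcounit_bilinear : bilinear_for *:%R *:%R lcounit_fun.
Proof.
split=> [b|b] a x y; rewrite /lcounit_fun.
  by rewrite linearP scalerDl -scalerA.
by rewrite scalerDr scalerA mulrC -scalerA.
Qed.

Lemma rcounit_bilinear : bilinear_for *:%R *:%R rcounit_fun.
Proof.
split=> [b|b] a x y; rewrite /rcounit_fun.
  by rewrite scalerDr scalerA mulrC -scalerA.
by rewrite linearP scalerDl -scalerA.
Qed.

HB.instance Definition _ := bilinear_isBilinear.Build k H H H
  *:%R *:%R lcounit_fun lcounit_bilinear.
HB.instance Definition _ := bilinear_isBilinear.Build k H H H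
  *:%R *:%R rcounit_fun rcounit_bilinear.

Record is_hopf_algebra : Prop := IsHopfAlgebra {
  hopf_mulA : associative (hmul A);
  hopf_mul1l : left_id (hone A) (hmul A);
  hopf_mul1r : right_id (hone A) (hmul A);
  hopf_coassoc : forall x,
    tassoc (tmap (hcomul A) idfun (hcomul A x)) =
      tmap idfun (hcomul A) (hcomul A x);
  hopf_counitl : forall x, tlift lcounit_fun (hcomul A x) = x;
  hopf_counitr : forall x, tlift rcounit_fun (hcomul A x) = x;
  hopf_counit1 : hcounit A (hone A) = 1;
  hopf_counitM : forall x y,
    hcounit A (hmul A x y) = (hcounit A x : k) * hcounit A y;
  hopf_comul1 : hcomul A (hone A) = tens (hone A) (hone A);
  hopf_comulM : forall x y,
    hcomul A (hmul A x y) = tmul (hcomul A x) (hcomul A y);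
  hopf_antipode : exists S : {linear H -> H}, is_antipode S }.

End Ops.

Record is_hopf_iso (H H' : lmodType k) (A : hopf_ops H) (A' : hopf_ops H')
    (f : {linear H -> H'}) : Prop := IsHopfIso {
  hopf_iso_source : is_hopf_algebra A;
  hopf_iso_target : is_hopf_algebra A';
  hopf_iso_bij : bijective f;
  hopf_iso_one : f (hone A) = hone A';
  hopf_iso_mul : forall x y, f (hmul A x y) = hmul A' (f x) (f y);
  hopf_iso_counit : forall x, hcounit A' (f x) = hcounit A x;
  hopf_iso_comul : forall x, hcomul A' (f x) = tmap f f (hcomul A x);
  hopf_iso_antipode : forall S S' : {linear _ -> _},
    is_antipode A S -> is_antipode A' S' -> forall x, f (S x) = S' (f x) }.

End HopfAlgebra.

Section TensorSpace.
Variables (k : fieldType) (V : lmodType k).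

(** The relations preserve the length of words, so their quotient is the direct
    sum over n of the quotients of the free modules on words of length n by the
    multilinearity relations, that is of the n-th tensor powers of V. *)
Inductive multilinear_rel : {freeg (seq V) / k} -> Prop :=
| MultilinearRel p s a x y :
    multilinear_rel (<< p ++ (a *: x + y) :: s >>
                     - (a *: << p ++ x :: s >> + << p ++ y :: s >>)).

Definition tspace : Type := presented multilinear_rel.

HB.instance Definition _ := GRing.Lmodule.on tspace.

Definition word (xs : seq V) : tspace := pgen multilinear_rel xs.

Definition multilinear (M : lmodType k) (f : seq V -> M) : Prop :=
  forall p s a x y,
    f (p ++ (a *: x + y) :: s) = a *: f (p ++ x :: s) + f (p ++ y :: s).

Lemma word_multilinear : multilinear word.
Proof.
by move=> p s a x y; apply: pgen_rel; constructor.
Qed.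

Section Lift.
Variable M : lmodType k.

Lemma wlift_subproof (f : seq V -> M) : multilinear f ->
  forall r, multilinear_rel r -> fglift f r = 0.
Proof.
by move=> fP _ [p s a x y]; apply: fglift_rel.
Qed.

Definition wlift (f : seq V -> M) (fP : multilinear f) : tspace -> M :=
  plift (wlift_subproof fP).

HB.instance Definition _ f (fP : multilinear f) :=
  GRing.Linear.copy (wlift fP) (plift (wlift_subproof fP)).

Lemma wlift_word f (fP : multilinear f) xs : wlift fP (word xs) = f xs.
Proof. by rewrite /wlift plift_gen. Qed.

Lemma tspace_ext (f g : {linear tspace -> M}) :
  (forall xs, f (word xs) = g (word xs)) -> f =1 g.
Proof. exact: presented_ext. Qed.

Lemma wlift_lin a (f g h : seq V -> M)
    (fP : multilinear f) (gP : multilinear g) (hP : multilinear h) z :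
  (forall xs, f xs = a *: g xs + h xs) ->
  wlift fP z = a *: wlift gP z + wlift hP z.
Proof.
move=> E; apply: (@tspace_ext (wlift fP) (a \*: wlift gP \+ wlift hP)) => xs /=.
by rewrite !wlift_word.
Qed.

End Lift.

Lemma prep_subproof a : multilinear (fun xs => word (a :: xs)).
Proof. by move=> p s c x y; apply: (word_multilinear (a :: p)). Qed.

(** prep a u is the element written a u: left concatenation with the letter a. *)
Definition prep (a : V) (u : tspace) : tspace := wlift (prep_subproof a) u.

Lemma prep_word a xs : prep a (word xs) = word (a :: xs).
Proof. exact: wlift_word. Qed.

Lemma prep_bilinear : bilinear_for *:%R *:%R prep.
Proof.
split=> [u|b] a x y; rewrite /prep; last exact: linearP.
by apply: wlift_lin => xs; apply: (word_multilinear [::]).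
Qed.

HB.instance Definition _ :=
  bilinear_isBilinear.Build k V tspace tspace *:%R *:%R prep prep_bilinear.

Lemma deconc_subproof : multilinear (fun xs =>
  \sum_(0 <= i < (size xs).+1) tens (word (take i xs)) (word (drop i xs))).
Proof.
move=> p s a x y; rewrite scaler_sumr !size_cat /= -big_split /=.
apply: eq_bigr => i _; rewrite !take_cat !drop_cat; case: ltnP => hi.
  by rewrite word_multilinear linearPr.
case: (i - size p)%N => [|j] /=; first by rewrite (word_multilinear [::]) linearPr.
by rewrite word_multilinear linearPl.
Qed.

Definition deconc (x : tspace) : tensor tspace tspace := wlift deconc_subproof x.

HB.instance Definition _ :=
  GRing.Linear.copy deconc (wlift deconc_subproof).

Lemma counit_subproof : multilinear (fun xs => (nilp xs)%:R : k^o).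
Proof. by move=> [|b p] s a x y; rewrite /= scaler0 addr0. Qed.

Definition counit (x : tspace) : k^o := wlift counit_subproof x.

HB.instance Definition _ :=
  GRing.Linear.copy counit (wlift counit_subproof).

Fixpoint sh (v : seq V) : seq V -> tspace :=
  if v is a :: v' then
    fix sh_v w := if w is b :: w' then
        prep a (sh v' w) + prep b (sh_v w')
      else word v
  else word.

Lemma sh_cons a v b w :
  sh (a :: v) (b :: w) = prep a (sh v (b :: w)) + prep b (sh (a :: v) w).
Proof. by []. Qed.

Lemma sh_nil v : sh v [::] = word v.
Proof. by case: v. Qed.

Section QuasiShuffle.
Variable mu : {bilinear V -> V -> V}.

Fixpoint qsh (v : seq V) : seq V -> tspace :=
  if v is a :: v' then
    fix qsh_v w := if w is b :: w' then
        prep a (qsh v' w) + prep b (qsh_v w') + prep (mu a b) (qsh v' w')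
      else word v
  else word.

Lemma qsh_cons a v b w : qsh (a :: v) (b :: w) =
  prep a (qsh v (b :: w)) + prep b (qsh (a :: v) w) + prep (mu a b) (qsh v w).
Proof. by []. Qed.

Lemma qsh_nil v : qsh v [::] = word v.
Proof. by case: v. Qed.

Lemma qsh_multilinear_r v : multilinear (qsh v).
Proof.
elim: v => [|b v IHv] p s a x y; first exact: word_multilinear.
elim: p => [|c p IHp].
  rewrite !cat0s !qsh_cons (IHv [::]) !cat0s !linearPr !linearPl.
  by rewrite !scalerDr; rewrite [RHS]addrACA; congr (_ + _); rewrite addrACA.
rewrite !cat_cons !qsh_cons -!cat_cons IHp (IHv (c :: p)) (IHv p) !linearPr.
by rewrite !scalerDr; rewrite [RHS]addrACA; congr (_ + _); rewrite addrACA.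
Qed.

Lemma qsh_multilinear_l w : multilinear (fun v => qsh v w).
Proof.
elim: w => [|b w IHw] p s a x y; first by rewrite !qsh_nil word_multilinear.
elim: p => [|c p IHp].
  rewrite !cat0s !qsh_cons (IHw [::]) !cat0s !linearPl !linearPr.
  by rewrite !scalerDr; rewrite [RHS]addrACA; congr (_ + _); rewrite addrACA.
rewrite !cat_cons !qsh_cons -!cat_cons IHp (IHw (c :: p)) (IHw p) !linearPr.
by rewrite !scalerDr; rewrite [RHS]addrACA; congr (_ + _); rewrite addrACA.
Qed.

Lemma qshuffle_subproof y :
  multilinear (fun v => wlift (qsh_multilinear_r v) y).
Proof.
move=> p s a x x'; apply: wlift_lin => w; exact: qsh_multilinear_l.
Qed.

Definition qshuffle (x y : tspace) : tspace := wlift (qshuffle_subproof y) x.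

Lemma qshuffle_bilinear : bilinear_for *:%R *:%R qshuffle.
Proof.
split=> [y|x] a u v; rewrite /qshuffle; first exact: linearP.
by apply: wlift_lin => w; rewrite linearP.
Qed.

HB.instance Definition _ := bilinear_isBilinear.Build k tspace tspace tspace
  *:%R *:%R qshuffle qshuffle_bilinear.

Lemma qshuffle_word v w : qshuffle (word v) (word w) = qsh v w.
Proof. by rewrite /qshuffle !wlift_word. Qed.

(** The product in V of a nonempty sequence; the value at [::] is irrelevant. *)
Definition vprod (ys : seq V) : V := if ys is y :: ys' then foldl mu y ys' else 0.

(** For shape i, the word whose letters are the products of the consecutive
    blocks of xs of lengths i_1, ..., i_m. *)
Definition contract (i : seq nat) (xs : seq V) : tspace :=
  word [seq vprod ys | ys <- reshape i xs].

(** A composition of n has all its parts at most n, so its parts can be taken in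
    'I_n.+1, which makes the index set of the inner sum finite. *)
Definition exp_word (xs : seq V) : tspace :=
  if xs is [::] then word [::] else
  let n := size xs in
  \sum_(1 <= m < n.+1)
    \sum_(i : m.-tuple 'I_n.+1 |
           (sumn (map val i) == n) && all (fun j : 'I_n.+1 => 0 < j)%N i)
      (\prod_(j <- i) (j`!)%:R)^-1 *: contract (map val i) xs.

Lemma vprod_linear p s a x y :
  vprod (p ++ (a *: x + y) :: s) =
    a *: vprod (p ++ x :: s) + vprod (p ++ y :: s).
Proof.
have F z z' : foldl mu (a *: z + z') s = a *: foldl mu z s + foldl mu z' s.
  by elim: s z z' => //= c s IH z z'; rewrite linearPl IH.
by case: p => [|b p] /=; rewrite ?foldl_cat /= ?linearPr F.
Qed.

Lemma contract_linear i p s a x y :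
  sumn i = (size p + (size s).+1)%N ->
  contract i (p ++ (a *: x + y) :: s) =
    a *: contract i (p ++ x :: s) + contract i (p ++ y :: s).
Proof.
rewrite /contract; elim: i p => [|j i IH] p /=; first by rewrite addnS.
move=> hs; rewrite !take_cat !drop_cat; case: ltnP => hj.
  rewrite -!prep_word IH ?linearPr //; apply/eqP.
  by rewrite -(eqn_add2l j) hs size_drop addnA subnKC // ltnW.
case: (j - size p)%N (subnKC hj) => [|j'] /= E.
  rewrite cats0 -!prep_word (IH [::]) ?linearPr //; apply/eqP.
  by rewrite -(eqn_add2l j) hs -E addn0.
by rewrite vprod_linear -!prep_word linearPl.
Qed.

Lemma exp_subproof : multilinear exp_word.
Proof.
have E xs : xs != [::] -> exp_word xs =
    \sum_(1 <= m < (size xs).+1)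
    \sum_(i : m.-tuple 'I_(size xs).+1 |
        (sumn (map val i) == size xs) && all (fun j : 'I__ => 0 < j)%N i)
      (\prod_(j <- i) (j`!)%:R)^-1 *: contract (map val i) xs by case: xs.
move=> p s a x y; rewrite !E; try by case: (p).
rewrite !size_cat /= scaler_sumr -big_split /=; apply: eq_bigr => m _.
rewrite scaler_sumr -big_split /=; apply: eq_bigr => i /andP[/eqP hi _].
by rewrite contract_linear // scalerDr !scalerA mulrC.
Qed.

Definition exp_map (x : tspace) : tspace := wlift exp_subproof x.

HB.instance Definition _ := GRing.Linear.copy exp_map (wlift exp_subproof).

Lemma exp_map_word xs : exp_map (word xs) = exp_word xs.
Proof. exact: wlift_word. Qed.

End QuasiShuffle.

Lemma sh_multilinear_r v : multilinear (sh v).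
Proof.
elim: v => [|b v IHv] p s a x y; first exact: word_multilinear.
elim: p => [|c p IHp].
  rewrite !cat0s !sh_cons (IHv [::]) !cat0s linearPl linearPr.
  by rewrite !scalerDr addrACA.
rewrite !cat_cons !sh_cons -!cat_cons IHp (IHv (c :: p)) !linearPr.
by rewrite !scalerDr addrACA.
Qed.

Lemma sh_multilinear_l w : multilinear (fun v => sh v w).
Proof.
elim: w => [|b w IHw] p s a x y; first by rewrite !sh_nil word_multilinear.
elim: p => [|c p IHp].
  rewrite !cat0s !sh_cons (IHw [::]) !cat0s linearPl linearPr.
  by rewrite !scalerDr addrACA.
rewrite !cat_cons !sh_cons -!cat_cons IHp (IHw (c :: p)) !linearPr.
by rewrite !scalerDr addrACA.
Qed.

Lemma shuffle_subproof y : multilinear (fun v => wlift (sh_multilinear_r v) y).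
Proof. by move=> p s a x x'; apply: wlift_lin => w; apply: sh_multilinear_l. Qed.

Definition shuffle (x y : tspace) : tspace := wlift (shuffle_subproof y) x.

Lemma shuffle_bilinear : bilinear_for *:%R *:%R shuffle.
Proof.
split=> [y|x] a u v; rewrite /shuffle; first exact: linearP.
by apply: wlift_lin => w; rewrite linearP.
Qed.

HB.instance Definition _ := bilinear_isBilinear.Build k tspace tspace tspace
  *:%R *:%R shuffle shuffle_bilinear.

Lemma shuffle_word v w : shuffle (word v) (word w) = sh v w.
Proof. by rewrite /shuffle !wlift_word. Qed.

Lemma deconc_word xs : deconc (word xs) =
  \sum_(0 <= i < (size xs).+1) tens (word (take i xs)) (word (drop i xs)).
Proof. exact: wlift_word. Qed.

Lemma counit_word xs : counit (word xs) = (nilp xs)%:R.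
Proof. exact: wlift_word. Qed.

Definition shuffle_hopf : hopf_ops tspace :=
  HopfOps (word [::]) shuffle counit deconc.

Definition qshuffle_hopf (mu : {bilinear V -> V -> V}) : hopf_ops tspace :=
  HopfOps (word [::]) (qshuffle mu) counit deconc.

End TensorSpace.

(* Main.v *)
(** Both products satisfy the quasi-shuffle recursion (for the shuffle product,
    with the zero product on V), which makes them Hopf products for
    deconcatenation: associativity and multiplicativity of the coproduct follow
    by induction on words, and the antipode is a convolution inverse, obtained
    as the solution of a fixed point equation that is local on word length.

    Write c p for the product in V of the letters of p divided by (size p)`!.
    Then phi xs is the sum of (c p) (phi q) over the deconcatenations of xs
    into p q with p nonempty. Hence phi is unitriangular for word length, thus
    bijective, and coassociativity makes it a coalgebra map. An element x is
    recovered from its counit and from (letter of x') x'', where x' and x''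
    come from deconcatenation, so that comparing the two coalgebra maps
    phi (u sh v) and phi u * phi v reduces, by induction on the total length,
    to comparing their components in V: these agree because the number
    of shuffles of words of lengths m and n is (m + n)! / (m! n!). *)
Require Import Defs.
From HB Require Import structures.
From mathcomp Require Import all_boot all_algebra sesquilinear.
From mathcomp Require Import generic_quotient freeg.
Set Implicit Arguments.
Unset Strict Implicit.
Unset Printing Implicit Defensive.
Import GRing.Theory.
Local Open Scope ring_scope.
Local Open Scope quotient_scope.

(** * Sums over the deconcatenations of a word *)

Section DeconcatenationSums.
Variable V : Type.
Implicit Types (xs p q r : seq V).

(** Sweedler notation for words: a linear map on [tensor T T] sends [deconc (word xs)] to a sum of
    this form. *)
Definition dsum (M : nmodType) (P : seq V -> seq V -> M) xs : M :=
  \sum_(0 <= i < (size xs).+1) P (take i xs) (drop i xs).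

Lemma dsum_nil (M : nmodType) (P : seq V -> seq V -> M) :
  dsum P [::] = P [::] [::].
Proof. by rewrite /dsum big_nat1. Qed.

Lemma dsum_cons (M : nmodType) (P : seq V -> seq V -> M) a xs :
  dsum P (a :: xs) = P [::] (a :: xs) + dsum (fun p q => P (a :: p) q) xs.
Proof. by rewrite /dsum big_nat_recl. Qed.

Lemma eq_dsum (M : nmodType) (P Q : seq V -> seq V -> M) xs :
  (forall p q, size xs = (size p + size q)%N -> P p q = Q p q) ->
  dsum P xs = dsum Q xs.
Proof.
move=> PQ; apply: eq_big_nat => i _; apply: PQ.
by rewrite -size_cat cat_take_drop.
Qed.

Lemma dsumD (M : nmodType) (P Q : seq V -> seq V -> M) xs :
  dsum (fun p q => P p q + Q p q) xs = dsum P xs + dsum Q xs.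
Proof. exact: big_split. Qed.

(** Coassociativity on words: both sides run over the cuts of [xs] into three consecutive pieces. *)
Lemma dsumA (M : nmodType) (K : seq V -> seq V -> seq V -> M) xs :
  dsum (fun x r => dsum (fun p q => K p q r) x) xs =
  dsum (fun p y => dsum (fun q r => K p q r) y) xs.
Proof.
elim: xs K => [|a xs IH] K; first by rewrite !dsum_nil.
rewrite !dsum_cons dsum_nil -addrA; congr (_ + _).
rewrite -IH -dsumD; apply: eq_dsum => p q _.
by rewrite dsum_cons.
Qed.

Lemma dsum_nill (M : nmodType) (P : seq V -> seq V -> M) xs :
  (forall a p q, P (a :: p) q = 0) -> dsum P xs = P [::] xs.
Proof.
case: xs => [|a xs] P0; first exact: dsum_nil.
by rewrite dsum_cons /dsum big1 ?addr0.
Qed.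

Lemma dsum_nilr (M : nmodType) (P : seq V -> seq V -> M) xs :
  (forall a p q, P p (a :: q) = 0) -> dsum P xs = P xs [::].
Proof.
elim: xs P => [|a xs IH] P P0; first exact: dsum_nil.
by rewrite dsum_cons P0 add0r IH // => b p q; rewrite P0.
Qed.

End DeconcatenationSums.

(** * Structure maps of the tensor space, evaluated on words *)

Section TensorSpace.
Variables (k : fieldType) (V : lmodType k).
Local Notation T := (tspace V).
Local Notation "1w" := (word ([::] : seq V)).
Implicit Types (x y z : T) (xs u v w : seq V).

Lemma lin_dsum (A B : lmodType k) (f : {linear A -> B})
    (P : seq V -> seq V -> A) xs :
  f (dsum P xs) = dsum (fun p q => f (P p q)) xs.
Proof. exact: linear_sum. Qed.

Lemma bilin_dsuml (A B C : lmodType k) (b : {bilinear A -> B -> C})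
    (P : seq V -> seq V -> A) xs (y : B) :
  b (dsum P xs) y = dsum (fun p q => b (P p q) y) xs.
Proof. exact: linear_sumlz. Qed.

Lemma bilin_dsumr (A B C : lmodType k) (b : {bilinear A -> B -> C})
    (P : seq V -> seq V -> B) xs (y : A) :
  b y (dsum P xs) = dsum (fun p q => b y (P p q)) xs.
Proof. exact: linear_sumr. Qed.

Lemma deconcE xs :
  deconc (word xs) = dsum (fun p q => tens (word p) (word q)) xs.
Proof. exact: deconc_word. Qed.

Lemma tspace_ind (P : T -> Prop) :
  (forall xs, P (word xs)) ->
  (forall a x y, P x -> P y -> P (a *: x + y)) -> forall x, P x.
Proof.
move=> Pw Pl x; rewrite -[x]reprK; move: (repr x).
elim/freeg_ind_dom0 => [|c xs D _ _ IH].
  (* Zero has to be reached from words by the closure property. *)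
  suff -> : \pi_(presented (@multilinear_rel k V)) 0 = -1 *: 1w + 1w.
    by apply: Pl.
  rewrite scaleN1r addNr -[RHS](scale0r 1w) /word /pgen -pi_presentedZ.
  by rewrite scale0r.
rewrite pi_presentedD.
have -> : << c *g xs >> = c *: << xs >> :> {freeg (seq V) / k}.
  by apply/eqP/freeg_eqP => t; rewrite coeffZ !coeffU mul1r.
by rewrite pi_presentedZ; apply: Pl => //; apply: Pw.
Qed.

(* The generic linearP, linearPl and linearPr leave the scaling operators to
   unification, which is very slow at [tspace V]. *)
Lemma linE (A B : lmodType k) (f : {linear A -> B}) c (x y : A) :
  f (c *: x + y) = c *: f x + f y.
Proof. exact: linearP. Qed.

Lemma bilinE_l (A B C : lmodType k) (f : {bilinear A -> B -> C}) c
    (x y : A) (z : B) :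
  f (c *: x + y) z = c *: f x z + f y z.
Proof. exact: linearPl. Qed.

Lemma bilinE_r (A B C : lmodType k) (f : {bilinear A -> B -> C}) c
    (x y : B) (z : A) :
  f z (c *: x + y) = c *: f z x + f z y.
Proof. exact: linearPr. Qed.

Lemma bilinDl (A B C : lmodType k) (f : {bilinear A -> B -> C})
    (x y : A) (z : B) :
  f (x + y) z = f x z + f y z.
Proof. exact: linearDl. Qed.

Lemma bilinDr (A B C : lmodType k) (f : {bilinear A -> B -> C})
    (x y : B) (z : A) :
  f z (x + y) = f z x + f z y.
Proof. exact: linearDr. Qed.

Local Notation TT := (tensor T T).
Definition deconcL : {linear T -> TT} := @deconc k V.
Definition prepL : {bilinear V -> T -> T} := @prep k V.
Definition counitL : {linear T -> k^o} := @counit k V.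
Definition tensL : {bilinear T -> T -> TT} := @tens k T T.
Definition preptL a : {linear TT -> TT} := tmap (prepL a) idfun.

(** A cut falls before [a], or else [a] stays at the head of the left factor. This is the cocycle
    property of [prep a]. *)
Lemma deconc_prep a x :
  deconc (prep a x) = tens 1w (prep a x) + preptL a (deconc x).
Proof.
move: x; apply: (@tspace_ext k V TT (deconcL \o prepL a)
  ((tensL 1w \o prepL a) \+ (preptL a \o deconcL))) => xs /=.
rewrite /prepL /= prep_word [LHS]deconcE dsum_cons [deconcL _]deconcE.
rewrite (lin_dsum (preptL a)); congr (_ + _).
by apply: eq_dsum => p q _; rewrite [RHS]tmap_tens /= [prepL _ _]prep_word.
Qed.

Lemma counit_prep a x : counit (prep a x) = 0.
Proof.
move: x; apply: (@tspace_ext k V _ (counitL \o prepL a) \0) => xs /=.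
by rewrite /counitL /prepL /= prep_word counit_word.
Qed.

Lemma deconc_coassoc x :
  tassoc (tmap deconcL idfun (deconc x)) = tmap idfun deconcL (deconc x).
Proof.
pose f : {linear _ -> _} := @tassoc k T T T.
pose b1 : {bilinear TT -> T -> _} := @tens k TT T.
pose b2 : {bilinear T -> TT -> _} := @tens k T TT.
pose f1 : {linear TT -> _} := tmap deconcL idfun.
pose f2 : {linear TT -> _} := tmap idfun deconcL.
move: x; apply: (tspace_ext (f := f \o f1 \o deconcL)
  (g := f2 \o deconcL)) => xs /=.
rewrite [deconcL _]deconcE (lin_dsum f1) (lin_dsum f) (lin_dsum f2).
transitivity (dsum (fun s r => dsum (fun p q =>
    tens (word p) (tens (word q) (word r))) s) xs).
  apply: eq_dsum => p q _; rewrite [f1 _]tmap_tens [deconcL _]deconcE.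
  rewrite [X in f X](bilin_dsuml b1) (lin_dsum f).
  by apply: eq_dsum => r s _; rewrite [LHS]tassoc_tens.
rewrite dsumA; apply: eq_dsum => p y _.
rewrite [RHS]tmap_tens /= [deconcL _]deconcE.
have E := bilin_dsumr b2 (fun q r => tens (word q) (word r)) y (word p).
exact: esym E.
Qed.

End TensorSpace.

(** * Inductive step for associativity *)

(** The seven premises are the instances of associativity in which a nonempty subset of the first
    letters [a], [b], [c] has been removed. *)
Lemma quasi_shuffle_assoc_step (L : Type) (H : zmodType) (mu : L -> L -> L)
    (p : L -> H -> H) (m : H -> H -> H)
    (muA : associative mu)
    (pD : forall a x y, p a (x + y) = p a x + p a y)
    (mDl : forall x y z, m (x + y) z = m x z + m y z)
    (mDr : forall x y z, m z (x + y) = m z x + m z y)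
    (mM : forall a b x y, m (p a x) (p b y) =
       p a (m x (p b y)) + p b (m (p a x) y) + p (mu a b) (m x y))
    a b c x y z :
  m x (m y z) = m (m x y) z ->
  m x (m (p b y) z) = m (m x (p b y)) z ->
  m x (m y (p c z)) = m (m x y) (p c z) ->
  m x (m (p b y) (p c z)) = m (m x (p b y)) (p c z) ->
  m (p a x) (m y z) = m (m (p a x) y) z ->
  m (p a x) (m y (p c z)) = m (m (p a x) y) (p c z) ->
  m (p a x) (m (p b y) z) = m (m (p a x) (p b y)) z ->
  m (p a x) (m (p b y) (p c z)) = m (m (p a x) (p b y)) (p c z).
Proof.
move=> E1 E2 E3 E4 E5 E6 E7.
(* Each of the first three terms of S collects three of the nine terms of the
   expansion of either side, by the recursion read backwards. *)
pose S := p a (m x (m (p b y) (p c z)))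
  + p b (m (p a x) (m y (p c z))) + p c (m (p a x) (m (p b y) z))
  + p (mu a b) (m x (m y (p c z))) + p (mu a c) (m x (m (p b y) z))
  + p (mu b c) (m (p a x) (m y z)) + p (mu a (mu b c)) (m x (m y z)).
transitivity S.
  rewrite /S (mM b c) !mDr !mM !pD !addrA.
  by rewrite [LHS](ACl (1*4*7*2*5*3*6*8*9)).
rewrite /S E1 E2 E3 E4 E5 E6 E7 (mM a b) !mDl !mM !pD !addrA.
by rewrite muA [LHS](ACl (1*3*7*2*4*8*6*5*9)).
Qed.

(** * Extension of identities from a spanning family, given by its induction principle *)

Section SpannedModule.
Variables (k : fieldType) (V H H' : lmodType k) (I : Type) (e : I -> H).
Hypothesis H_ind : forall P : H -> Prop, (forall i, P (e i)) ->
  (forall a x y, P x -> P y -> P (a *: x + y)) -> forall x, P x.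
Implicit Types (m : {bilinear H -> H -> H}) (x y z : H).

Lemma span_associative m :
  (forall i j l, m (e i) (m (e j) (e l)) = m (m (e i) (e j)) (e l)) ->
  associative m.
Proof.
move=> mA x y z; elim/H_ind: x => [i|c x x' IHx IHx']; last first.
  by rewrite !linearPl IHx IHx'.
elim/H_ind: y => [j|c y y' IHy IHy']; last first.
  by rewrite linearPl !linearPr linearPl IHy IHy'.
by elim/H_ind: z => [l|c z z' IHz IHz'] //; rewrite !linearPr IHz IHz'.
Qed.

Lemma span_multiplicative m (m' : {bilinear H' -> H' -> H'})
    (f : {linear H -> H'}) :
  (forall i j, f (m (e i) (e j)) = m' (f (e i)) (f (e j))) ->
  forall x y, f (m x y) = m' (f x) (f y).
Proof.
move=> fM x y; elim/H_ind: x => [i|c x x' IHx IHx']; last first.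
  by rewrite linearPl !linearP linearPl IHx IHx'.
elim/H_ind: y => [j|c y y' IHy IHy'] //.
by rewrite linearPr !linearP /= IHy IHy'.
Qed.

Lemma span_recursion m (p : {bilinear V -> H -> H}) a b c :
  (forall i j, m (p a (e i)) (p b (e j)) =
     p a (m (e i) (p b (e j))) + p b (m (p a (e i)) (e j))
     + p c (m (e i) (e j))) ->
  forall x y, m (p a x) (p b y) =
     p a (m x (p b y)) + p b (m (p a x) y) + p c (m x y).
Proof.
have E d x1 x2 x3 y1 y2 y3 : d *: (x1 + x2 + x3) + (y1 + y2 + y3) =
    d *: x1 + y1 + (d *: x2 + y2) + (d *: x3 + y3) :> H.
  by rewrite !scalerDr [LHS]addrACA; congr (_ + _); rewrite addrACA.
move=> mM x y; elim/H_ind: x => [i|d x x' IHx IHx']; last first.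
  by rewrite !linearPr !linearPl !linearPr IHx IHx' E.
elim/H_ind: y => [j|d y y' IHy IHy'] //.
by rewrite !linearPr IHy IHy' E.
Qed.

End SpannedModule.

(** * Bialgebra axioms from the quasi-shuffle recursion *)

Section QuasiShuffleHopf.
Variables (k : fieldType) (V : lmodType k).
Local Notation T := (tspace V).
Local Notation TT := (tensor T T).
Local Notation "1w" := (word ([::] : seq V)).
Implicit Types (x y z : T) (xs u v w : seq V).

Lemma tensDl x y z : tens (x + y) z = tens x z + tens y z.
Proof. exact: (bilinDl (tensL V)). Qed.

Lemma tensDr x y z : tens z (x + y) = tens z x + tens z y.
Proof. exact: (bilinDr (tensL V)). Qed.

Lemma deconcD x y : deconc (x + y) = deconc x + deconc y.
Proof. exact: (raddfD (deconcL V)). Qed.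

Section Product.
Variables (mu : V -> V -> V) (m : {bilinear T -> T -> T}).
Hypothesis m1l : left_id 1w m.
Hypothesis m1r : right_id 1w m.
Hypothesis mM : forall a b x y, m (prep a x) (prep b y) =
  prep a (m x (prep b y)) + prep b (m (prep a x) y) + prep (mu a b) (m x y).

Let A := HopfOps 1w m (@counit k V) (@deconc k V).

Lemma product_associative : associative mu -> associative m.
Proof.
move=> muA.
apply: (span_associative (@tspace_ind k V)) => u v w.
elim: u v w => [|a u IHu] v w; first by rewrite !m1l.
elim: v w => [|b v IHv] w; first by rewrite m1l m1r.
elim: w => [|c w IHw]; first by rewrite !m1r.
(* The seven induction hypotheses, in the order of the premises of [quasi_shuffle_assoc_step]. *)
move: (IHu v w) (IHu (b :: v) w) (IHu v (c :: w)) (IHu (b :: v) (c :: w))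
  (IHv w) (IHv (c :: w)) IHw.
rewrite -!prep_word.
apply: (quasi_shuffle_assoc_step muA _ _ _ mM).
- by move=> *; apply: (bilinDr (prepL V)).
- by move=> *; apply: (bilinDl m).
- by move=> *; apply: (bilinDr m).
Qed.

(** For two nonempty words every term of the recursion begins with a letter, so both sides
    vanish. *)
Lemma counitM x y : counit (m x y) = (counit x : k) * counit y.
Proof.
elim/tspace_ind: x => [u|c x x' IHx IHx']; last first.
  by rewrite (bilinE_l m) !(linE (counitL V)) /= IHx IHx' /= mulrDl -mulrA.
elim/tspace_ind: y => [v|c y y' IHy IHy']; last first.
  by rewrite (bilinE_r m) !(linE (counitL V)) /= IHy IHy' /= mulrDr mulrCA.
case: u v => [|a u] [|b v]; rewrite ?m1l ?m1r ?counit_word ?mul1r ?mulr1 //=.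
by rewrite -!prep_word mM !(raddfD (counitL V)) /= !counit_prep !addr0 mulr0.
Qed.

(** Linearity in the second factor; in the first it is built into [tlift]. *)
Lemma tmul_linear Z : linear (tmul A Z).
Proof.
move=> c Y Y'; apply: tlift_lin => a b.
by rewrite /= /tmul_fun linearP.
Qed.

Lemma tmul_dsum (P Q : seq V -> seq V -> tensor T T) u v :
  tmul A (dsum P u) (dsum Q v) =
  dsum (fun p q => dsum (fun r s => tmul A (P p q) (Q r s)) v) u.
Proof.
rewrite /tmul lin_dsum; apply: eq_dsum => p q _.
pose tmulr := GRing.isLinear.Build k _ _ *:%R _ (tmul_linear (P p q)).
pose f : {linear _ -> _} := HB.pack (tmul A (P p q)) tmulr.
exact: (lin_dsum f).
Qed.

Lemma preptL_dsum2 a (u v : seq V) (P Q : seq V -> seq V -> T) :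
  preptL a (dsum (fun p q => dsum (fun r s => tens (P p r) (Q q s)) v) u) =
  dsum (fun p q => dsum (fun r s => tens (prep a (P p r)) (Q q s)) v) u.
Proof.
rewrite lin_dsum; apply: eq_dsum => p q _.
rewrite lin_dsum; apply: eq_dsum => r s _.
exact: tmap_tens.
Qed.

Lemma tens_mM a b (p q r s : seq V) :
  tens (m (word (a :: p)) (word (b :: r))) (m (word q) (word s)) =
  tens (prep a (m (word p) (word (b :: r)))) (m (word q) (word s)) +
  tens (prep b (m (word (a :: p)) (word r))) (m (word q) (word s)) +
  tens (prep (mu a b) (m (word p) (word r))) (m (word q) (word s)).
Proof.
rewrite -!(prep_word a) -!(prep_word b) mM.
by rewrite !tensDl.
Qed.

(** Induction on both words. On the left, [deconc_prep] treats each term of the recursion; on the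
    right, empty prefixes are split off and the recursion is applied in the left tensor factor. *)
Lemma deconcM_word u v :
  deconc (m (word u) (word v)) =
  dsum (fun p q => dsum (fun r s =>
    tens (m (word p) (word r)) (m (word q) (word s))) v) u.
Proof.
elim: u v => [|a u IHu] v.
  rewrite dsum_nil m1l deconcE; apply: eq_dsum => r s _.
  by rewrite !m1l.
elim: v => [|b v IHv].
  rewrite m1r deconcE; apply: eq_dsum => p q _.
  by rewrite dsum_nil !m1r.
have mcons : m (word (a :: u)) (word (b :: v)) =
    prep a (m (word u) (word (b :: v))) + prep b (m (word (a :: u)) (word v))
    + prep (mu a b) (m (word u) (word v)).
  by rewrite -!(prep_word a) -!(prep_word b) mM.
rewrite [in LHS]mcons !deconcD !deconc_prep !IHu IHv !preptL_dsum2.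
rewrite [in RHS]dsum_cons [dsum (fun r s => tens (m 1w _) _) _]dsum_cons.
(* For prefixes starting with [a], an empty [r] contributes by the unit law to the [prep a] sum
   only. Hence that sum runs over [b :: v] and the other two over [v]. *)
have -> : dsum (fun p q => dsum (fun r s =>
      tens (m (word (a :: p)) (word r)) (m (word q) (word s))) (b :: v)) u =
    dsum (fun p q => dsum (fun r s =>
      tens (prep a (m (word p) (word r))) (m (word q) (word s))) (b :: v)) u +
    dsum (fun p q => dsum (fun r s =>
      tens (prep b (m (word (a :: p)) (word r))) (m (word q) (word s))) v) u +
    dsum (fun p q => dsum (fun r s =>
      tens (prep (mu a b) (m (word p) (word r))) (m (word q) (word s))) v) u.
  rewrite -!dsumD; apply: eq_dsum => p q _; rewrite !dsum_cons !m1r prep_word.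
  rewrite -!addrA; congr (_ + _); rewrite -!dsumD.
  by apply: eq_dsum => r s _; rewrite tens_mM addrA.
have -> : dsum (fun r s =>
      tens (m 1w (word (b :: r))) (m (word (a :: u)) (word s))) v =
    dsum (fun r s =>
      tens (prep b (m 1w (word r))) (m (word (a :: u)) (word s))) v.
  by apply: eq_dsum => r s _; rewrite !m1l prep_word.
(* The term with both prefixes empty splits by the recursion in its right factor; the seven terms
   then agree up to order. *)
rewrite (dsum_cons _ a) m1l mcons !tensDr !addrA.
by rewrite [LHS](ACl (1*3*6*4*2*5*7)).
Qed.

Lemma tmul_linear_l Y c Z Z' :
  tmul A (c *: Z + Z') Y = c *: tmul A Z Y + tmul A Z' Y.
Proof. exact: linE. Qed.

Lemma deconc_lin c x y : deconc (c *: x + y) = c *: deconc x + deconc y.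
Proof. exact: (linE (deconcL V)). Qed.

Lemma deconcM x y : deconc (m x y) = tmul A (deconc x) (deconc y).
Proof.
elim/tspace_ind: x => [u|c x x' IHx IHx']; last first.
  by rewrite (bilinE_l m) !deconc_lin tmul_linear_l IHx IHx'.
elim/tspace_ind: y => [v|c y y' IHy IHy']; last first.
  by rewrite (bilinE_r m) !deconc_lin tmul_linear IHy IHy'.
rewrite deconcM_word !deconcE tmul_dsum.
apply: eq_dsum => p q _; apply: eq_dsum => r s _.
by rewrite tmul_tens.
Qed.

End Product.
End QuasiShuffleHopf.

(** * Fixed points local on word length, convolution inverses, antipodes *)

Section Inverses.
Variables (k : fieldType) (V : lmodType k).
Local Notation T := (tspace V).
Local Notation "1w" := (word ([::] : seq V)).
Implicit Types (x y z : T) (xs u v w : seq V).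

(** The neutral element for convolution. *)
Definition unit_counit x : T := (counit x : k) *: (1w : T).

Lemma unit_counit_linear : linear unit_counit.
Proof.
by move=> c x y; rewrite /unit_counit (linE (counitL V)) scalerDl scalerA.
Qed.

HB.instance Definition _ :=
  GRing.isLinear.Build k T T *:%R unit_counit unit_counit_linear.

Definition unitL : {linear T -> T} := unit_counit.

Lemma unitL_cons a xs : unitL (word (a :: xs)) = 0.
Proof. by rewrite /unitL /= /unit_counit counit_word scale0r. Qed.

Lemma unitL_nil : unitL 1w = 1w.
Proof. by rewrite /unitL /= /unit_counit counit_word scale1r. Qed.

Section WordFixpoint.
Variables (M : lmodType k) (F : {linear T -> M} -> {linear T -> M}).
Hypothesis F_local : forall (f g : {linear T -> M}) xs,
  (forall ys, (size ys < size xs)%N -> f (word ys) = g (word ys)) ->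
  F f (word xs) = F g (word xs).

Lemma word_fixpoint_unique (f g : {linear T -> M}) :
  f =1 F f -> g =1 F g -> f =1 g.
Proof.
move=> fF gF; apply: tspace_ext => xs.
have [n] := ubnP (size xs); elim: n xs => // n IH xs le_n.
rewrite fF gF; apply: F_local => ys lt_ys; apply: IH.
exact: leq_trans lt_ys le_n.
Qed.

(** By locality the iterates of [F] from zero are stationary on words of length less than [n] from
    the [n]-th iterate on, so the limit can be read off at the iterate [(size xs).+1]. *)
Lemma word_fixpoint : exists f : {linear T -> M}, f =1 F f.
Proof.
pose Z : {linear T -> M} := \0.
pose G n := iter n F Z.
have G_stable n xs : (size xs < n)%N -> G n (word xs) = G n.+1 (word xs).
  elim: n xs => // n IH xs le_n; apply: F_local => ys lt_ys; apply: IH.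
  exact: leq_trans lt_ys le_n.
have G_eq n xs : (size xs < n)%N -> G n (word xs) = G (size xs).+1 (word xs).
  elim: n => // n IH; rewrite ltnS leq_eqVlt => /predU1P[->//|lt_n].
  by rewrite -G_stable ?IH.
(* The three words of a multilinearity relation have the same length, so one and the same iterate is
   evaluated on them. *)
have X_lin : multilinear (fun xs => G (size xs).+1 (word xs)).
  move=> p s a x y; rewrite !size_cat /= word_multilinear.
  exact: linE.
pose X : {linear T -> M} := wlift X_lin.
have X_word xs : X (word xs) = G (size xs).+1 (word xs) by apply: wlift_word.
exists X; apply: tspace_ext => xs.
rewrite X_word; apply: F_local => ys lt_ys.
by rewrite X_word G_eq.
Qed.

End WordFixpoint.

Section Convolution.
Variable m : {bilinear T -> T -> T}.
Hypothesis m1l : left_id 1w m.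
Hypothesis m1r : right_id 1w m.
Hypothesis mA : associative m.
Let A := HopfOps 1w m (@counit k V) (@deconc k V).
Implicit Types f g h : {linear T -> T}.

Definition convL f g : {linear T -> T} := tlift (conv_fun A f g) \o deconcL V.

Lemma conv_word f g xs :
  conv A f g (word xs) = dsum (fun p q => m (f (word p)) (g (word q))) xs.
Proof.
rewrite /conv /= deconcE lin_dsum.
by apply: eq_dsum => p q _; apply: tlift_tens.
Qed.

Lemma conv_unitl f g xs : (forall a p, f (word (a :: p)) = 0) -> f 1w = 1w ->
  dsum (fun p q => m (f (word p)) (g (word q))) xs = g (word xs).
Proof.
move=> f0 f1; rewrite dsum_nill ?f1 ?m1l // => a p q.
by rewrite f0 linear0l.
Qed.

Lemma conv_unitr f g xs : (forall a p, g (word (a :: p)) = 0) -> g 1w = 1w ->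
  dsum (fun p q => m (f (word p)) (g (word q))) xs = f (word xs).
Proof.
move=> g0 g1; rewrite dsum_nilr ?g1 ?m1r // => a p q.
by rewrite g0 linear0r.
Qed.

(** A left and a right inverse of [g] coincide: the triple convolution of [f], [g], [h] is bracketed
    in both ways, by [dsumA] and [mA]. *)
Lemma conv_inverse_eq f g h :
  (forall x, conv A f g x = unit_counit x) ->
  (forall x, conv A g h x = unit_counit x) -> f =1 h.
Proof.
move=> fg gh; apply: tspace_ext => xs.
have fgw ys : unitL (word ys) =
    dsum (fun p q => m (f (word p)) (g (word q))) ys.
  by rewrite -conv_word fg.
have ghw ys : unitL (word ys) =
    dsum (fun p q => m (g (word p)) (h (word q))) ys.
  by rewrite -conv_word gh.
rewrite -(conv_unitr f xs unitL_cons unitL_nil).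
rewrite -[RHS](conv_unitl h xs unitL_cons unitL_nil).
under [RHS]eq_dsum => p q _ do rewrite fgw (bilin_dsuml m).
rewrite dsumA; apply: eq_dsum => p y _.
rewrite ghw (bilin_dsumr m); apply: eq_dsum => q r _.
exact: mA.
Qed.

(** The inverse solves the fixed point equation that adds to the unit the convolution of
    [J = unitL - f] with [g]. As [J] kills the empty word, only values of [g] on shorter words
    enter. The conclusion [g 1w = 1w] allows a second application, to [g]. *)
Lemma conv_right_inverse f : f 1w = 1w ->
  exists2 g : {linear T -> T}, g 1w = 1w &
    forall x, conv A f g x = unit_counit x.
Proof.
move=> f1.
pose J : {linear T -> T} := unitL \- f.
have J1 y : m (J 1w) y = 0.
  by rewrite /J /= unitL_nil f1 subrr (linear0l m).
pose F g : {linear T -> T} := unitL \+ convL J g.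
have FE g xs : F g (word xs) =
    unitL (word xs) + dsum (fun p q => m (J (word p)) (g (word q))) xs.
  by rewrite -conv_word.
have [g gF] : exists g : {linear T -> T}, g =1 F g.
  apply: (@word_fixpoint T F) => g h xs gh.
  suff E : dsum (fun p q => m (J (word p)) (g (word q))) xs =
           dsum (fun p q => m (J (word p)) (h (word q))) xs.
    exact: etrans (FE g xs) (etrans (congr1 _ E) (esym (FE h xs))).
  case: xs gh => [|a xs] gh; first by rewrite !dsum_nil !J1.
  rewrite !dsum_cons !J1 !add0r; apply: eq_dsum => p q s_xs.
  by rewrite gh //= s_xs ltnS leq_addl.
exists g; first by rewrite gF FE dsum_nil J1 addr0 unitL_nil.
apply: (tspace_ext (f := convL f g) (g := unitL)) => xs.
rewrite [LHS]conv_word; have := gF (word xs); rewrite FE.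
have -> : dsum (fun p q => m (J (word p)) (g (word q))) xs =
   dsum (fun p q => m (unitL (word p)) (g (word q))) xs
   - dsum (fun p q => m (f (word p)) (g (word q))) xs.
  rewrite /dsum -sumrB; apply: eq_bigr => i _; exact: (linearBl m).
rewrite (conv_unitl g xs unitL_cons unitL_nil) addrCA.
by rewrite -[LHS]addr0 => /addrI/esym/subr0_eq.
Qed.

(** The right inverse [g] of [f] has a right inverse [h] in turn; then [f] equals [h], so [g] is
    two-sided. *)
Lemma conv_inverse f : f 1w = 1w -> exists g : {linear T -> T},
  forall x, conv A g f x = unit_counit x /\ conv A f g x = unit_counit x.
Proof.
move=> /conv_right_inverse[g /conv_right_inverse[h h1 gh] fg].
exists g => x; split=> //.
rewrite -gh; have fh := conv_inverse_eq fg gh.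
move: x; apply: (tspace_ext (f := convL g f) (g := convL g h)) => xs /=.
by rewrite [LHS]conv_word [RHS]conv_word; apply: eq_dsum => p q _; rewrite fh.
Qed.

End Convolution.

Lemma counitl_deconc (A : hopf_ops T) x :
  hcounit A = counitL V -> hcomul A = deconcL V ->
  tlift (lcounit_fun A) (hcomul A x) = x.
Proof.
move=> Ec Ed; rewrite Ed.
move: x; apply: (tspace_ext (f := tlift (lcounit_fun A) \o deconcL V)
  (g := idfun)) => xs.
rewrite [_ (word _)]/= [deconcL V _]deconcE lin_dsum.
transitivity (dsum (fun p q => (counit (word p) : k) *: (word q : T)) xs).
  by apply: eq_dsum => p q _; rewrite [LHS]tlift_tens /= /lcounit_fun Ec.
rewrite dsum_nill => [|a p q]; rewrite counit_word ?scale1r //.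
exact: scale0r.
Qed.

Lemma counitr_deconc (A : hopf_ops T) x :
  hcounit A = counitL V -> hcomul A = deconcL V ->
  tlift (rcounit_fun A) (hcomul A x) = x.
Proof.
move=> Ec Ed; rewrite Ed.
move: x; apply: (tspace_ext (f := tlift (rcounit_fun A) \o deconcL V)
  (g := idfun)) => xs.
rewrite [_ (word _)]/= [deconcL V _]deconcE lin_dsum.
transitivity (dsum (fun p q => (counit (word q) : k) *: (word p : T)) xs).
  by apply: eq_dsum => p q _; rewrite [LHS]tlift_tens /= /rcounit_fun Ec.
rewrite dsum_nilr => [|a p q]; rewrite counit_word ?scale1r //.
exact: scale0r.
Qed.

(** Here [mu] is a bare function, so the constant zero function covers the shuffle product. The
    antipode is the convolution inverse of [idfun]. *)
Lemma quasi_shuffle_hopf (mu : V -> V -> V) (m : {bilinear T -> T -> T}) :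
  associative mu -> left_id 1w m -> right_id 1w m ->
  (forall a b x y, m (prep a x) (prep b y) =
    prep a (m x (prep b y)) + prep b (m (prep a x) y)
    + prep (mu a b) (m x y)) ->
  is_hopf_algebra (HopfOps 1w m (@counit k V) (@deconc k V)).
Proof.
move=> muA m1l m1r mM; have mA := product_associative m1l m1r mM muA.
split=> //=.
- exact: deconc_coassoc.
- by move=> x; apply: counitl_deconc.
- by move=> x; apply: counitr_deconc.
- by rewrite counit_word.
- exact: (counitM m1l m1r mM).
- by rewrite deconcE dsum_nil.
- exact: (deconcM m1l m1r mM).
by have [|S SP] := @conv_inverse m m1l m1r mA idfun; last exists S.
Qed.

End Inverses.

(** * Recursion for phi on the first block of a composition *)

Section ExpWords.
Variables (k : fieldType) (V : lmodType k).
Local Notation T := (tspace V).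
Local Notation "1w" := (word ([::] : seq V)).
Implicit Types (x y z : T) (xs u v w : seq V).

Lemma prepZ c d a x : prep (c *: a) (d *: x) = (c * d) *: prep a x.
Proof.
have Z (A B C : lmodType k) (f : {bilinear A -> B -> C}) (y : A) (z : B) :
    f (c *: y) (d *: z) = (c * d) *: f y z.
  by rewrite linearZl_LR linearZr_LR /= scalerA.
exact: (Z _ _ _ (prepL V)).
Qed.

Section ExpRecursion.
Variable mu : {bilinear V -> V -> V}.

(** The letter contributed by a block [xs]; it is zero on the empty word because [vprod] is. *)
Definition exp_coef xs : V := (((size xs)`!)%:R : k)^-1 *: vprod mu xs.

(* The part of [exp_word xs] indexed by the compositions with [n] parts, by
   recursion on the first part. *)
Fixpoint exp_parts n xs : T :=
  if n is n'.+1 then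
    if xs is a :: s then
      dsum (fun p q => prep (exp_coef (a :: p)) (exp_parts n' q)) s
    else 0
  else if nilp xs then 1w else 0.

Lemma contract_cons j i xs :
  contract mu (j :: i) xs =
    prep (vprod mu (take j xs)) (contract mu i (drop j xs)).
Proof. by rewrite /contract /= prep_word. Qed.

(** The bound [B] is independent of [size xs], so that the index type stays fixed when the induction
    passes from [xs] to a suffix. *)
Lemma exp_partsE B n xs : (size xs <= B)%N ->
  \sum_(i : n.-tuple 'I_B.+1 | (sumn (map val i) == size xs)
        && all (fun j : 'I_B.+1 => 0 < j)%N i)
    (\prod_(j <- i) (j`!)%:R)^-1 *: contract mu (map val i) xs
  = exp_parts n xs.
Proof.
elim: n xs => [|n IH] xs le_xs.
  case: xs {le_xs} => [|a xs].
    rewrite (big_pred1 [tuple]) => [|i]; last by rewrite [i]tuple0 [RHS]eqxx.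
    by rewrite /= big_nil invr1 scale1r.
  by rewrite big_pred0 // => i; rewrite [i]tuple0.
rewrite (reindex (fun p : 'I_B.+1 * n.-tuple 'I_B.+1 =>
  [tuple of p.1 :: p.2])) /=; last first.
  exists (fun t => (thead t, [tuple of behead t])) => [[j i]|t] _ /=.
    by congr pair; apply: val_inj.
  by rewrite -tuple_eta.
pose P (j : nat) := ((0 < j) && (j < (size xs).+1))%N.
transitivity (\sum_(j : 'I_B.+1 | P j)
    prep (exp_coef (take j xs)) (exp_parts n (drop j xs))).
  transitivity (\sum_(j : 'I_B.+1 | P j) \sum_(i : n.-tuple 'I_B.+1 |
     (sumn (map val i) == size (drop j xs))
     && all (fun j : 'I_B.+1 => 0 < j)%N i)
     (\prod_(l <- j :: i) (l`!)%:R)^-1 *: contract mu (val j :: map val i) xs).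
    rewrite pair_big_dep; apply: eq_bigl => -[j i] /=.
    rewrite /P ltnS size_drop; case: (posnP j) => [->|j0].
      by rewrite andbF.
    rewrite /=; case: leqP => [le_j|lt_j].
      by rewrite -[in RHS](eqn_add2l j) subnKC.
    by rewrite gtn_eqF // (leq_trans lt_j) // leq_addr.
  apply: eq_bigr => j /andP[j0 jn].
  rewrite -IH; last by rewrite size_drop (leq_trans (leq_subr _ _)).
  rewrite (linear_sumr (prepL V)); apply: eq_bigr => i _.
  rewrite big_cons contract_cons invfM /exp_coef size_takel //.
  exact/esym/prepZ.
(* The range is cut down to first parts from 1 to [size xs]; a shift by one makes it the range of a
   [dsum] over the tail of [xs]. *)
rewrite -(big_mkord P (fun j =>
  prep (exp_coef (take j xs)) (exp_parts n (drop j xs)))).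
rewrite /P -(big_nat_widen 0 _ _ _ _ (_ : (size xs).+1 <= B.+1)%N) //.
rewrite big_ltn_cond //= big_add1 /=.
case: xs {le_xs P} => [|a xs]; first by rewrite big_geq.
by [].
Qed.

Lemma exp_parts_gt n xs : (size xs < n)%N -> exp_parts n xs = 0.
Proof.
elim: n xs => // n IH [|a xs] //= lt_n; rewrite /dsum big1_seq // => i _.
rewrite IH ?(linear0r (prepL V)) // size_drop.
exact: leq_ltn_trans (leq_subr _ _) _.
Qed.

(** The free bound gives all suffixes in [exp_word_cons] a common range, so that the two sums can be
    exchanged. *)
Lemma exp_word_parts B xs : (size xs <= B)%N ->
  exp_word mu xs = \sum_(0 <= n < B.+1) exp_parts n xs.
Proof.
move=> le_B; rewrite (big_cat_nat (n := (size xs).+1)) //=.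
rewrite [X in _ = _ + X]big_nat_cond [X in _ = _ + X]big1 => [|n]; last first.
  by case/andP=> /andP[lt_n _] _; apply: exp_parts_gt.
rewrite addr0; case: xs {le_B} => [|a xs]; first by rewrite big_nat1.
rewrite big_ltn // [exp_parts 0 _]/= add0r /exp_word.
by apply: eq_bigr => n _; apply: exp_partsE.
Qed.

(** Compositions are grouped by their first block [a :: p]. Later facts about [exp_word] on nonempty
    words rest on this recursion. *)
Lemma exp_word_cons a xs : exp_word mu (a :: xs) =
  dsum (fun p q => prep (exp_coef (a :: p)) (exp_word mu q)) xs.
Proof.
rewrite (exp_word_parts (leqnn _)) big_nat_recl // [exp_parts 0 _]/= add0r.
rewrite /dsum exchange_big; apply: eq_big_nat => i /andP[_ lt_i] /=.
rewrite (exp_word_parts (B := size xs)) ?size_drop ?leq_subr //.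
exact/esym/(linear_sumr (prepL V)).
Qed.

End ExpRecursion.
End ExpWords.

(** * Additive cancellations for the fixed point equation of an inverse *)

Section ZmoduleIdentities.
Variable M : zmodType.
Implicit Types a b c d e : M.

Lemma addr_subr_congr e a b c d : a - b = c - d -> e + c - a = e + d - b.
Proof.
move=> E; have -> : a = c - d + b by rewrite -E subrK.
by rewrite opprD opprB addrA addrACA subrr addr0.
Qed.

Lemma addr_subr_id a b c : b = a + b - c -> c = a.
Proof. by rewrite [a + b]addrC -addrA -[LHS]addr0 => /addrI/esym/subr0_eq. Qed.

Lemma add0r_subr0 a b : b = 0 -> a = 0 + a - b.
Proof. by move=> ->; rewrite add0r subr0. Qed.

End ZmoduleIdentities.

(** * Bijectivity of phi and compatibility with the coalgebra structure *)

Section ExpCoalgebra.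
Variables (k : fieldType) (V : lmodType k).
Local Notation T := (tspace V).
Local Notation TT := (tensor T T).
Local Notation "1w" := (word ([::] : seq V)).
Implicit Types (x y z : T) (xs u v w : seq V).

(** The hypothesis says dually that [f (word xs)] is [word xs] up to shorter words. It makes the map
    sending [g] to [idfun + g - g \o f] local, and a fixed point of that map is a left inverse of
    [f]. *)
Lemma unitriangular_bijective (f : {linear T -> T}) :
  (forall (g : {linear T -> T}) xs,
     (forall ys, (size ys < size xs)%N -> g (word ys) = 0) ->
     g (f (word xs)) = g (word xs)) ->
  bijective f.
Proof.
move=> f_tri.
pose Z : {linear T -> T} := \0.
pose F (e g : {linear T -> T}) : {linear T -> T} := (e \+ g) \- (g \o f).
have F_local e (g h : {linear T -> T}) xs :
    (forall ys, (size ys < size xs)%N -> g (word ys) = h (word ys)) ->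
    F e g (word xs) = F e h (word xs).
  move=> gh; pose d : {linear T -> T} := g \- h.
  apply: (addr_subr_congr (e (word xs))); apply: (f_tri d) => ys lt_ys.
  by rewrite /d /= gh // subrr.
have [g gF] := word_fixpoint (F_local idfun).
have gf : cancel f g by move=> x; apply: addr_subr_id (gF x).
exists g => // x.
(* Since [d \o f] is zero, [d] and the zero map both solve the fixed point equation with [e]
   zero. *)
pose d : {linear T -> T} := (f \o g) \- idfun.
suff : d =1 Z by move=> /(_ x) /= /subr0_eq.
apply: (word_fixpoint_unique (F_local Z)) => y.
  by apply: (@add0r_subr0 _ (d y)); rewrite /d /= gf subrr.
by rewrite /F /Z /= addr0 subr0.
Qed.

Section Exp.
Variable mu : {bilinear V -> V -> V}.

Definition expL : {linear T -> T} := exp_map mu.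

(** Dual form of the fact that phi does not increase word length. *)
Lemma exp_word_lower (M : lmodType k) n (f : {linear T -> M}) xs :
  (forall ys, (size ys <= n)%N -> f (word ys) = 0) ->
  (size xs <= n)%N -> f (exp_word mu xs) = 0.
Proof.
elim: n f xs => [|n IH] f [|a xs] f0 // le_xs; try exact: (f0 [::]).
rewrite exp_word_cons lin_dsum /dsum big1 // => i _.
pose g : {linear T -> M} := f \o prepL V (exp_coef mu (a :: take i xs)).
apply: (IH g) => [ys le_ys|].
  by rewrite /g /= [prepL V _ _]prep_word f0.
by rewrite size_drop (leq_trans (leq_subr _ _)).
Qed.

Lemma exp_coef1 a : exp_coef mu [:: a] = a.
Proof. by rewrite /exp_coef /= invr1 scale1r. Qed.

(** The first block [[:: a]] yields the leading word by induction; a longer first block yields only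
    shorter words, killed through [exp_word_lower]. *)
Lemma exp_word_unitriangular (M : lmodType k) (f : {linear T -> M}) xs :
  (forall ys, (size ys < size xs)%N -> f (word ys) = 0) ->
  f (exp_word mu xs) = f (word xs).
Proof.
elim: xs f => // a xs IH f f0; rewrite exp_word_cons.
pose g c : {linear T -> M} := f \o prepL V c.
have gE : f (word (a :: xs)) = g a (exp_word mu xs).
  rewrite IH => [|ys lt_ys]; rewrite /g /= [prepL V _ _]prep_word //.
  exact: f0.
rewrite gE; case: xs {IH gE} f0 => [|b xs] f0.
  by rewrite dsum_nil exp_coef1.
rewrite dsum_cons exp_coef1 linearD [X in _ + X]lin_dsum.
rewrite /dsum big1 ?addr0 // => i _.
apply: (@exp_word_lower _ (size xs) (g _)) => [ys le_ys|].
  by rewrite /g /= [prepL V _ _]prep_word f0.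
by rewrite size_drop leq_subr.
Qed.

Lemma exp_bijective : bijective expL.
Proof.
apply: unitriangular_bijective => g xs g0.
by rewrite [expL _]exp_map_word exp_word_unitriangular.
Qed.

Lemma counit_exp x : counit (expL x) = counit x.
Proof.
move: x; apply: (tspace_ext (f := counitL V \o expL) (g := counitL V)) => xs /=.
rewrite [expL _]exp_map_word; case: xs => [|a xs] //.
rewrite exp_word_cons lin_dsum [RHS]counit_word /dsum big1 // => i _.
exact: counit_prep.
Qed.

(** A cut falls before or after the first block. In the second case [dsumA] regroups the pieces so
    that the first block and the middle piece form the left factor. *)
Lemma deconc_exp_word xs : deconc (exp_word mu xs) =
  dsum (fun p q => tens (exp_word mu p) (exp_word mu q)) xs.
Proof.
have [n] := ubnP (size xs); elim: n xs => // n IH [|a xs] lt_n.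
  by rewrite /= deconcE !dsum_nil.
rewrite dsum_cons exp_word_cons (lin_dsum (deconcL V)).
transitivity (dsum (fun p q =>
    tens 1w (prep (exp_coef mu (a :: p)) (exp_word mu q)) +
    dsum (fun q r =>
      tens (prep (exp_coef mu (a :: p)) (exp_word mu q)) (exp_word mu r)) q)
    xs).
  apply: eq_dsum => p q s_xs; rewrite [LHS]deconc_prep IH; last first.
    by move: lt_n; rewrite /= ltnS s_xs; apply/leq_ltn_trans/leq_addl.
  congr (_ + _); rewrite lin_dsum; apply: eq_dsum => r s _.
  exact: tmap_tens.
rewrite dsumD; congr (_ + _); first exact/esym/(lin_dsum (tensL V 1w)).
rewrite -dsumA; apply: eq_dsum => p q _.
rewrite exp_word_cons; exact/esym/(bilin_dsuml (tensL V)).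
Qed.

Lemma deconc_exp x : deconc (expL x) = tmap expL expL (deconc x).
Proof.
pose e2 : {linear TT -> TT} := tmap expL expL.
move: x; apply: (tspace_ext (f := deconcL V \o expL)
  (g := e2 \o deconcL V)) => xs.
rewrite /= [expL _]exp_map_word [LHS]deconc_exp_word.
rewrite [deconcL V _]deconcE lin_dsum.
apply: eq_dsum => p q _.
by rewrite [RHS]tmap_tens /= [expL _]exp_map_word [expL _]exp_map_word.
Qed.

End Exp.
End ExpCoalgebra.

(** * Multiplicativity of phi *)

Section ExpAlgebra.
Variables (k : fieldType) (V : lmodType k).
Local Notation T := (tspace V).
Local Notation TT := (tensor T T).
Local Notation "1w" := (word ([::] : seq V)).
Implicit Types (x y z : T) (xs u v w : seq V).

Lemma prep0 x : prep 0 x = 0.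
Proof. exact: (linear0l (prepL V)). Qed.

Lemma product_prep (mu : V -> V -> V) (m : {bilinear T -> T -> T}) :
  (forall a b u v, m (word (a :: u)) (word (b :: v)) =
     prep a (m (word u) (word (b :: v))) + prep b (m (word (a :: u)) (word v))
     + prep (mu a b) (m (word u) (word v))) ->
  forall a b x y, m (prep a x) (prep b y) =
    prep a (m x (prep b y)) + prep b (m (prep a x) y) + prep (mu a b) (m x y).
Proof.
move=> mw a b.
apply: (span_recursion (@tspace_ind k V) (m := m) (p := prepL V)) => u v.
by rewrite /prepL /= !prep_word mw.
Qed.

Lemma qshuffle_prep (mu : {bilinear V -> V -> V}) a b x y :
  qshuffle mu (prep a x) (prep b y) =
    prep a (qshuffle mu x (prep b y)) + prep b (qshuffle mu (prep a x) y)
    + prep (mu a b) (qshuffle mu x y).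
Proof.
apply: (product_prep (m := qshuffle mu)) => {}a {}b u v.
by rewrite /= !qshuffle_word.
Qed.

Lemma shuffle_prep a b x y :
  shuffle (prep a x) (prep b y) =
    prep a (shuffle x (prep b y)) + prep b (shuffle (prep a x) y)
    + prep 0 (shuffle x y).
Proof.
apply: (product_prep (mu := fun _ _ => 0) (m := @shuffle k V)) => {}a {}b u v.
by rewrite /= !shuffle_word prep0 addr0.
Qed.

Lemma qshuffle1l (mu : {bilinear V -> V -> V}) : left_id 1w (qshuffle mu).
Proof.
elim/tspace_ind=> [xs|c x y IHx IHy]; last first.
  by rewrite (bilinE_r (qshuffle mu)) /= IHx IHy.
exact: qshuffle_word.
Qed.

Lemma qshuffle1r (mu : {bilinear V -> V -> V}) : right_id 1w (qshuffle mu).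
Proof.
elim/tspace_ind=> [xs|c x y IHx IHy]; last first.
  by rewrite (bilinE_l (qshuffle mu)) /= IHx IHy.
by rewrite qshuffle_word qsh_nil.
Qed.

Lemma shuffle1l : left_id 1w (@shuffle k V).
Proof.
elim/tspace_ind=> [xs|c x y IHx IHy]; last first.
  by rewrite (bilinE_r (@shuffle k V)) /= IHx IHy.
exact: shuffle_word.
Qed.

Lemma shuffle1r : right_id 1w (@shuffle k V).
Proof.
elim/tspace_ind=> [xs|c x y IHx IHy]; last first.
  by rewrite (bilinE_l (@shuffle k V)) /= IHx IHy.
by rewrite shuffle_word sh_nil.
Qed.

Definition letter_word xs : V := if xs is [:: a] then a else 0.

Lemma letter_subproof : multilinear letter_word.
Proof.
by move=> [|b [|c p]] [|d s] a x y //=; rewrite scaler0 addr0.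
Qed.

(* The projection of the tensor space onto its summand V. *)
Definition letter : {linear T -> V} := wlift letter_subproof.

Lemma letterE xs : letter (word xs) = letter_word xs.
Proof. exact: wlift_word. Qed.

Lemma letter_prep a x : letter (prep a x) = (counit x : k) *: a.
Proof.
elim/tspace_ind: x => [xs|c x y IHx IHy]; last first.
  rewrite (bilinE_r (prepL V)) (linE letter) (linE (counitL V)) IHx IHy.
  by rewrite scalerDl scalerA.
rewrite prep_word letterE counit_word.
by case: xs => [|b xs]; rewrite /= ?scale1r ?scale0r.
Qed.

Definition glue_fun x y : T := prep (letter x) y.

Lemma glue_bilinear : bilinear_for *:%R *:%R glue_fun.
Proof.
split=> [y|x] c x' y'; rewrite /glue_fun.
  by rewrite (linE letter); apply: (bilinE_l (prepL V)).
exact: (bilinE_r (prepL V)).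
Qed.

HB.instance Definition _ := bilinear_isBilinear.Build k T T T
  *:%R *:%R glue_fun glue_bilinear.

Definition glue : {linear TT -> T} := tlift glue_fun.

Lemma glue_tens x y : glue (tens x y) = prep (letter x) y.
Proof. exact: tlift_tens. Qed.

(** Only the cut after the first letter contributes, since [letter] kills all prefixes of other
    lengths. *)
Lemma glue_deconc x : unit_counit x + glue (deconc x) = x.
Proof.
move: x; apply: (tspace_ext (f := unitL V \+ (glue \o deconcL V))
  (g := idfun)) => xs.
rewrite /= [deconcL V _]deconcE lin_dsum.
transitivity (unitL V (word xs) +
  dsum (fun p q => prep (letter_word p) (word q)) xs).
  congr (_ + _); apply: eq_dsum => p q _.
  by rewrite [LHS]glue_tens letterE.
case: xs => [|a xs]; first by rewrite unitL_nil dsum_nil prep0 addr0.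
rewrite unitL_cons dsum_cons prep0 !add0r dsum_nill => [|b p q].
  exact: prep_word.
exact: prep0.
Qed.

Section Multiplicative.
Variable mu : {bilinear V -> V -> V}.
Hypotheses (muA : associative mu) (muC : commutative mu).

Lemma foldl_mu_l (x y : V) s : foldl mu (mu x y) s = mu x (foldl mu y s).
Proof. by elim: s y => //= c s IH y; rewrite -muA IH. Qed.

Lemma foldl_mu_insert (x b : V) (s t : seq V) :
  foldl mu x (s ++ b :: t) = foldl mu (mu x b) (s ++ t).
Proof.
rewrite !foldl_cat /=; congr (foldl _ _ t).
by elim: s x => //= c s IH x; rewrite IH -!muA (muC b).
Qed.

(* The (size u + size v) choose (size u) words of the shuffle of u and v all
   have the same product in V. *)
Lemma linear_sh (M : lmodType k) (g : {linear T -> M}) (f : V -> M) (x : V)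
    u v :
  (forall xs, size xs = (size u + size v)%N ->
     g (word xs) = f (foldl mu x xs)) ->
  g (sh u v) = f (foldl mu x (u ++ v)) *+ 'C(size u + size v, size u).
Proof.
elim: u v g x => [|a u IHu] v g x gf; first by rewrite bin0 mulr1n gf.
elim: v g x gf => [|b v IHv] g x gf.
  by rewrite sh_nil addn0 binn mulr1n cats0 gf // addn0.
rewrite sh_cons (linearD g).
have := IHu (b :: v) (g \o prepL V a) (mu x a).
rewrite /= => ->; last first.
  by move=> xs s_xs; rewrite [prepL V _ _]prep_word gf //= s_xs.
have := IHv (g \o prepL V b) (mu x b).
rewrite /= => ->; last first.
  by move=> xs s_xs; rewrite [prepL V _ _]prep_word gf //= s_xs addnS.
(* Moving [b] behind [a :: u] makes the two products equal; their multiplicities add up by Pascal's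
   rule. *)
rewrite -[foldl mu (mu (mu x b) a) _]/(foldl mu (mu x b) ((a :: u) ++ v)).
rewrite -(foldl_mu_insert x b (a :: u) v) /= -mulrnDr; congr (_ *+ _).
by rewrite [in RHS]addSn binS [LHS]addnC addSnnS.
Qed.

Hypothesis chark0 : [pchar k] =i pred0.

(** With i and j the two lengths and n = i + j, the shuffle has n! / (i! j!) words, and [g] maps
    each to the same product divided by n!. *)
Lemma exp_coef_sh (g : {linear T -> V}) a u b v :
  (forall xs, g (word xs) = exp_coef mu xs) ->
  g (sh (a :: u) (b :: v)) =
    mu (exp_coef mu (a :: u)) (exp_coef mu (b :: v)).
Proof.
move=> gE; pose n := ((size u).+1 + (size v).+1)%N.
pose f (x : V) : V := ((n`!)%:R : k)^-1 *: x.
rewrite sh_cons (linearD g).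
(* As V has no unit, each half of the recursion takes its own first letter as initial value of the
   fold. *)
have := @linear_sh _ (g \o prepL V a) f a u (b :: v).
rewrite /= => ->; last first.
  by move=> xs s_xs; rewrite [prepL V _ _]prep_word gE /exp_coef /= s_xs.
have := @linear_sh _ (g \o prepL V b) f b (a :: u) v.
rewrite /= => ->; last first.
  move=> xs s_xs; rewrite [prepL V _ _]prep_word gE /exp_coef /= s_xs.
  by rewrite /f /n addnS.
rewrite [mu b a]muC -(foldl_mu_insert a b u v) -mulrnDr.
have -> : ('C(size u + (size v).+1, size u)
    + 'C((size u).+1 + size v, (size u).+1))%N = 'C(n, (size u).+1).
  by rewrite /n [in RHS]addSn binS [LHS]addnC addSnnS.
rewrite /exp_coef /f -scaler_nat scalerA foldl_cat /= foldl_mu_l.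
rewrite linearZl_LR linearZr_LR /= scalerA; congr (_ *: _).
(* Writing n! as the binomial coefficient times i! j! lets the coefficient cancel; it is invertible
   in characteristic 0. *)
have := @bin_fact n (size u).+1; rewrite /n leq_addr addKn => /(_ isT) <-.
rewrite !natrM !invfM mulVKf //.
by rewrite ((pcharf0P k).1 chark0) -lt0n bin_gt0 leq_addr.
Qed.

Lemma counit_exp_word xs : counit (exp_word mu xs) = (nilp xs)%:R.
Proof. by rewrite -exp_map_word -counit_word; apply: (counit_exp mu). Qed.

(** Only the composition with a single block has a component in V. *)
Lemma letter_exp xs : letter (exp_word mu xs) = exp_coef mu xs.
Proof.
case: xs => [|a xs]; first by rewrite letterE /exp_coef scaler0.
rewrite exp_word_cons lin_dsum.
transitivity (dsum (fun p q => ((nilp q)%:R : k) *: exp_coef mu (a :: p)) xs).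
  apply: eq_dsum => p q _; rewrite [LHS]letter_prep.
  by rewrite counit_exp_word.
by rewrite dsum_nilr ?scale1r // => b p q; rewrite scale0r.
Qed.

(** The first two terms of the recursion keep a further letter, so only the [mu a b] term can have a
    component in V. *)
Lemma letter_qshuffle a b x y :
  letter (qshuffle mu (prep a x) (prep b y)) =
    (counit x * counit y : k) *: mu a b.
Proof.
rewrite qshuffle_prep !(linearD letter) !letter_prep.
rewrite !(counitM (@qshuffle1l mu) (@qshuffle1r mu) (@qshuffle_prep mu)).
by rewrite !counit_prep mulr0 mul0r !scale0r !add0r.
Qed.

Lemma letter_mul_exp u v :
  letter (expL mu (sh u v)) =
  letter (qshuffle mu (exp_word mu u) (exp_word mu v)).
Proof.
case: u v => [|a u] v; first by rewrite qshuffle1l [expL _ _]exp_map_word.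
case: v => [|b v]; first by rewrite sh_nil qshuffle1r [expL _ _]exp_map_word.
pose g : {linear T -> V} := letter \o expL mu.
rewrite [LHS](@exp_coef_sh g) => [|xs]; last first.
  by rewrite /g /= [expL _ _]exp_map_word letter_exp.
rewrite !exp_word_cons (bilin_dsuml (qshuffle mu)) lin_dsum.
transitivity (dsum (fun p q => dsum (fun r s =>
    ((nilp q)%:R * (nilp s)%:R : k) *:
      mu (exp_coef mu (a :: p)) (exp_coef mu (b :: r))) v) u).
  (* Only [q] and [s] both empty survive, that is, one block on each side. *)
  rewrite dsum_nilr => [|e p q]; last first.
    by rewrite /dsum big1 // => i _; rewrite mul0r scale0r.
  rewrite dsum_nilr => [|e r s]; last by rewrite mulr0 scale0r.
  by rewrite mulr1 scale1r.
apply: eq_dsum => p q _.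
rewrite [X in _ = letter X](bilin_dsumr (qshuffle mu)) lin_dsum.
apply: eq_dsum => r s _.
by rewrite [RHS]letter_qshuffle !counit_exp_word.
Qed.

Lemma exp_mul_word u v :
  expL mu (sh u v) = qshuffle mu (exp_word mu u) (exp_word mu v).
Proof.
have [n] := ubnP (size u + size v)%N; elim: n u v => // n IH u v lt_n.
rewrite -[LHS]glue_deconc -[RHS]glue_deconc; congr (_ + _).
  rewrite /unit_counit; congr (_ *: _).
  rewrite (counitM (@qshuffle1l mu) (@qshuffle1r mu) (@qshuffle_prep mu)).
  rewrite counit_exp -shuffle_word (counitM shuffle1l shuffle1r shuffle_prep).
  by rewrite !counit_exp_word !counit_word.
pose e2 : {linear TT -> TT} := tmap (expL mu) (expL mu).
transitivity (dsum (fun p q => dsum (fun r s =>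
    prep (letter (expL mu (sh p r))) (expL mu (sh q s))) v) u).
  rewrite deconc_exp -shuffle_word.
  rewrite (deconcM_word shuffle1l shuffle1r shuffle_prep).
  rewrite (lin_dsum e2) lin_dsum; apply: eq_dsum => p q _.
  rewrite (lin_dsum e2) lin_dsum; apply: eq_dsum => r s _.
  by rewrite [e2 _]tmap_tens [LHS]glue_tens /= !shuffle_word.
transitivity (dsum (fun p q => dsum (fun r s =>
    prep (letter (qshuffle mu (exp_word mu p) (exp_word mu r)))
      (qshuffle mu (exp_word mu q) (exp_word mu s))) v) u); last first.
  rewrite (deconcM (@qshuffle1l mu) (@qshuffle1r mu) (@qshuffle_prep mu)).
  rewrite !deconc_exp_word tmul_dsum lin_dsum; apply: eq_dsum => p q _.
  rewrite lin_dsum; apply: eq_dsum => r s _.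
  by rewrite [X in _ = glue X]tmul_tens [RHS]glue_tens.
apply: eq_dsum => p q s_u; apply: eq_dsum => r s s_v.
(* If [p] and [r] are both empty, the total length does not drop, but the letter is zero on both
   sides. Otherwise the induction hypothesis applies to [q] and [s]. *)
rewrite letter_mul_exp; case: (posnP (size p + size r)%N) => [|pr_gt0].
  case: p {s_u} => //; case: r {s_v} => // _.
  by rewrite [qshuffle mu _ _]qshuffle1l letterE !prep0.
congr (prep _ _); apply: IH.
move: lt_n; rewrite s_u s_v addnACA ltnS; apply: leq_trans.
by rewrite -[X in (X < _)%N]add0n ltn_add2r.
Qed.

Lemma expM x y : expL mu (shuffle x y) = qshuffle mu (expL mu x) (expL mu y).
Proof.
move: x y.
apply: (span_multiplicative (@tspace_ind k V) (m := @shuffle k V)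
  (m' := qshuffle mu) (f := expL mu)) => u v.
rewrite /= shuffle_word [LHS]exp_mul_word.
by rewrite [expL _ _]exp_map_word [expL _ _]exp_map_word.
Qed.

End Multiplicative.
End ExpAlgebra.

(** * Compatibility with antipodes, and the isomorphism *)

(** For convolution with the quasi-shuffle product, [f \o S] is a left inverse of phi because phi is
    multiplicative, and [S' \o f] is a right inverse because phi respects the coproduct; so they
    agree. *)
Lemma exp_antipode (k : fieldType) (chark0 : [pchar k] =i pred0)
    (V : lmodType k) (mu : {bilinear V -> V -> V})
    (muA : associative mu) (muC : commutative mu)
    (S S' : {linear tspace V -> tspace V}) :
  is_antipode (shuffle_hopf V) S -> is_antipode (qshuffle_hopf mu) S' ->
  forall x, expL mu (S x) = S' (expL mu x).
Proof.
move=> antiS antiS'.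
have qmul1l := @qshuffle1l k V mu; have qmul1r := @qshuffle1r k V mu.
have qmulA := product_associative qmul1l qmul1r (@qshuffle_prep k V mu) muA.
pose f : {linear tspace V -> tspace V} := expL mu.
apply: (conv_inverse_eq qmul1l qmul1r qmulA
  (f := f \o S) (g := f) (h := S' \o f)).
  apply: (tspace_ext (f := convL (qshuffle mu) (f \o S) f)
    (g := unitL V)) => xs.
  rewrite [LHS]conv_word.
  transitivity (f (conv (shuffle_hopf V) S idfun (word xs))).
    rewrite (conv_word (@shuffle k V)) lin_dsum; apply: eq_dsum => p q _.
    exact/esym/expM.
  rewrite (antiS _).1 linearZ; congr (_ *: _).
  exact: exp_map_word.
apply: (tspace_ext (f := convL (qshuffle mu) f (S' \o f))
  (g := unitL V)) => xs.
rewrite [LHS]conv_word.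
transitivity (conv (qshuffle_hopf mu) idfun S' (f (word xs))); last first.
  rewrite (antiS' _).2; congr (_ *: _).
  exact: counit_exp.
rewrite /conv /= [f _]exp_map_word deconc_exp_word lin_dsum.
apply: eq_dsum => p q _.
rewrite [RHS]tlift_tens /= /conv_fun /=.
by rewrite /f [expL _ _]exp_map_word [expL _ _]exp_map_word.
Qed.

Theorem corollary30 (k : fieldType) (chark0 : [pchar k] =i pred0)
    (V : lmodType k) (mu : {bilinear V -> V -> V})
    (muA : associative mu) (muC : commutative mu) :
  is_hopf_iso (shuffle_hopf V) (qshuffle_hopf mu) (exp_map mu).
Proof.
split.
- by apply: (quasi_shuffle_hopf _ (@shuffle1l k V) (@shuffle1r k V)
    (@shuffle_prep k V)).
- exact: (quasi_shuffle_hopf muA (@qshuffle1l k V mu) (@qshuffle1r k V mu)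
    (@qshuffle_prep k V mu)).
- exact: exp_bijective.
- exact: exp_map_word.
- exact: expM.
- exact: counit_exp.
- exact: deconc_exp.
- exact: exp_antipode.
Qed.
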